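(* Let $\alpha\in\mathbb{Z}$, $\alpha\neq0,1$, let $\beta=(2\alpha-1)(\alpha-1)$, and let $$E_8:\ y^2+(\alpha-\beta)xy-\alpha^3\beta y=x^3-\alpha^2\beta x^2,$$ an elliptic curve (in Tate normal form, rescaled to be integral) on which $P=(0,0)$ is a torsion point of order $8$. Let $G_n=\phi_n(P)$ and $H_n=\omega_n(P)$, $n\ge0$, be the sequences of numerators of the $x$- and $y$-coordinates of the multiples of $P$. Then for all $n\ge0$ (congruences modulo the number in parentheses): $$G_n=\begin{cases}0,& n\equiv1,7\ (8)\\ \alpha^{(15n^2+a_1)/8}(\alpha-1)^{(7n^2-b_1)/8}(2\alpha-1)^{(3n^2+c_1)/4},&\text{otherwise,}\end{cases}$$ $$H_n=\begin{cases}0,& n\equiv1,6\ (8)\\ \varepsilon\,\alpha^{(45n^2+a_2)/16}(\alpha-1)^{(21n^2-b_2)/16}(2\alpha-1)^{(9n^2-c_2)/8},&\text{otherwise,}\end{cases}$$ where: - $a_1=0,4,1,8$ and $b_1=0,4,7,8$ according as $n\equiv0$; $n\equiv2,6$; $n\equiv3,5$; $n\equiv4\ (8)$ respectively; - $c_1=0$ if $n\equiv0,2,4,6\ (8)$, and $c_1=1$ if $n\equiv3,5\ (8)$; - $\varepsilon=+1$ if $n\equiv0,4,5,10,13\ (16)$, and $\varepsilon=-1$ if $n\equiv2,3,7,8,11,12,15\ (16)$; - $a_2=0,-4,11,16,-5,3$ according as $n\equiv0,2,3,4,5,7\ (8)$ respectively; - $b_2=0$ if $n\equiv0$; $4$ if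 $n\equiv2$; $13$ if $n\equiv3,5$; $16$ if $n\equiv4$; $5$ if $n\equiv7\ (8)$; - $c_2=0$ if $n\equiv0,4$; $-4$ if $n\equiv2$; $1$ if $n\equiv3,7$; $-7$ if $n\equiv5\ (8)$.
   Context: Division polynomials. For an elliptic curve $y^{2}+a_{1}xy+a_{3}y=x^{3}+a_{2}x^{2}+a_{4}x+a_{6}$ put $b_2=a_1^2+4a_2$, $b_4=2a_4+a_1a_3$, $b_6=a_3^2+4a_6$, $b_8=a_1^2a_6+4a_2a_6-a_1a_3a_4+a_2a_3^2-a_4^2$ (these curve quantities are unrelated to the exponents $a_i,b_i,c_i$ in the claim). Define $\psi_0=0$, $\psi_1=1$, $\psi_2=2y+a_1x+a_3$, $\psi_3=3x^4+b_2x^3+3b_4x^2+3b_6x+b_8$, $\psi_4=\psi_2\,(2x^6+b_2x^5+5b_4x^4+10b_6x^3+10b_8x^2+(b_2b_8-b_4b_6)x+(b_4b_8-b_6^2))$, and $\psi_{2n+1}=\psi_{n+2}\psi_n^3-\psi_{n-1}\psi_{n+1}^3$ $(n\ge2)$, $\psi_{2n}\psi_2=\psi_{n-1}^2\psi_n\psi_{n+2}-\psi_{n-2}\psi_n\psi_{n+1}^2$ $(n\ge3)$. Further $\phi_0=1$, $\phi_1=x$, $\omega_0=1$, $\omega_1=y$, and for $n\ge2$: $\phi_n=x\psi_n^2-\psi_{n+1}\psi_{n-1}$, $\omega_n=\bigl(\psi_{n-1}^2\psi_{n+2}-\psi_{n-2}\psi_{n+1}^2-\psi_2\psi_n(a_1\phi_n+a_3\psi_n^2)\bigr)/(2\psi_2)$.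 If $\psi_n(P)\ne0$ then $[n]P=(\phi_n(P)/\psi_n(P)^2,\ \omega_n(P)/\psi_n(P)^3)$. *)

(* Defs.v *)
From HB Require Import structures.
From mathcomp Require Import all_boot all_order all_algebra.
From mathcomp Require Import zify ring lra.

Set Implicit Arguments.
Unset Strict Implicit.
Unset Printing Implicit Defensive.

Import Order.TTheory GRing.Theory Num.Theory.
Local Open Scope ring_scope.

(* y^2 + a1 x y + a3 y = x^3 + a2 x^2 + a4 x + a6 *)
Record weierstrass (F : Type) := Weierstrass {
  wa1 : F; wa2 : F; wa3 : F; wa4 : F; wa6 : F }.

Section DivisionPolynomials.

Variables (F : numFieldType) (E : weierstrass F).

Local Notation a1 := (wa1 E).
Local Notation a2 := (wa2 E).
Local Notation a3 := (wa3 E).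
Local Notation a4 := (wa4 E).
Local Notation a6 := (wa6 E).

Definition wb2 : F := a1 ^+ 2 + 4 * a2.
Definition wb4 : F := 2 * a4 + a1 * a3.
Definition wb6 : F := a3 ^+ 2 + 4 * a6.
Definition wb8 : F :=
  a1 ^+ 2 * a6 + 4 * a2 * a6 - a1 * a3 * a4 + a2 * a3 ^+ 2 - a4 ^+ 2.

Definition wdisc : F :=
  - wb2 ^+ 2 * wb8 - 8 * wb4 ^+ 3 - 27 * wb6 ^+ 2 + 9 * wb2 * wb4 * wb6.

(* F[x, y] is {poly {poly F}}: the inner variable is x, the outer one is y. *)
Definition bX : {poly {poly F}} := 'X%:P.
Definition bY : {poly {poly F}} := 'X.
Definition bC (c : F) : {poly {poly F}} := c%:P%:P.
Definition beval (p : {poly {poly F}}) (x y : F) : F := p.[y%:P].[x].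

Local Notation x := bX.
Local Notation y := bY.

Definition psi2 : {poly {poly F}} := 2 * y + bC a1 * x + bC a3.

Definition psi3 : {poly {poly F}} :=
  3 * x ^+ 4 + bC wb2 * x ^+ 3 + 3 * bC wb4 * x ^+ 2 + 3 * bC wb6 * x
  + bC wb8.

Definition psi4 : {poly {poly F}} :=
  psi2 * (2 * x ^+ 6 + bC wb2 * x ^+ 5 + 5 * bC wb4 * x ^+ 4
          + 10 * bC wb6 * x ^+ 3 + 10 * bC wb8 * x ^+ 2
          + bC (wb2 * wb8 - wb4 * wb6) * x + bC (wb4 * wb8 - wb6 ^+ 2)).

(* k is fuel. The divisor psi2 has the unit 2 as leading coefficient in y, so
   %/ is Euclidean division; psi_even shows that it is exact. *)
Fixpoint psi_rec (k n : nat) : {poly {poly F}} :=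
  match n with
  | 0 => 0
  | 1 => 1
  | 2 => psi2
  | 3 => psi3
  | 4 => psi4
  | _ =>
    if k is k'.+1 then
      let psi := psi_rec k' in
      let m := n./2 in
      if odd n then
        psi m.+2 * psi m ^+ 3 - psi m.-1 * psi m.+1 ^+ 3
      else
        (psi m.-1 ^+ 2 * psi m * psi m.+2
         - psi m.-2 * psi m * psi m.+1 ^+ 2) %/ psi2
    else 0
  end.

Definition psi (n : nat) : {poly {poly F}} := psi_rec n n.

Definition phi (n : nat) : {poly {poly F}} :=
  match n with
  | 0 => 1
  | 1 => x
  | _ => x * psi n ^+ 2 - psi n.+1 * psi n.-1
  end.

(* The division is exact in F[x, y], see omegaE. *)
Definition omega (n : nat) : {poly {poly F}} :=
  match n with
  | 0 => 1
  | 1 => y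
  | _ =>
    (psi n.-1 ^+ 2 * psi n.+2 - psi n.-2 * psi n.+1 ^+ 2
     - psi2 * psi n * (bC a1 * phi n + bC a3 * psi n ^+ 2)) %/ (2 * psi2)
  end.

Lemma psi_recS k n : psi_rec k.+1 n.+4.+1 =
  let m := n.+4.+1./2 in
  if odd n.+4.+1 then
    psi_rec k m.+2 * psi_rec k m ^+ 3 - psi_rec k m.-1 * psi_rec k m.+1 ^+ 3
  else
    (psi_rec k m.-1 ^+ 2 * psi_rec k m * psi_rec k m.+2
     - psi_rec k m.-2 * psi_rec k m * psi_rec k m.+1 ^+ 2) %/ psi2.
Proof. reflexivity. Qed.

Lemma psi_recE k n : (n <= k)%N -> psi_rec k n = psi n.
Proof.
rewrite /psi; elim/ltn_ind: n k => n IH k nk.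
case: n nk IH => [|[|[|[|[|n]]]]]; try by case: k.
case: k => [|k] nk IH; first by discriminate (nk : false = true).
have e i : (i <= n.+4)%N -> psi_rec k i = psi_rec n.+4 i.
  move=> lti; have ltk : (i <= k)%N by exact: leq_trans lti nk.
  by rewrite (IH i lti k ltk) (IH i lti n.+4 lti).
rewrite !psi_recS; cbv zeta.
have [h1 h2 h3] : [/\ (n.+4.+1./2.+2 <= n.+4)%N, (n.+4.+1./2.-1 <= n.+4)%N &
   (n.+4.+1./2.-2 <= n.+4)%N] by clear; split; lia.
have h4 : (n.+4.+1./2.+1 <= n.+4)%N by exact: ltnW.
have h5 : (n.+4.+1./2 <= n.+4)%N by exact: ltnW.
by rewrite (e _ h1) (e _ h2) (e _ h3) (e _ h4) (e _ h5).
Qed.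

Lemma psi_odd n : (2 <= n)%N ->
  psi n.*2.+1 = psi n.+2 * psi n ^+ 3 - psi n.-1 * psi n.+1 ^+ 3.
Proof.
case: n => [|[|n]] // _.
rewrite {1}/psi !doubleS psi_recS; cbv zeta.
have -> : odd n.*2.+4.+1 by rewrite /= odd_double.
have -> : (n.*2.+4.+1)./2 = n.+2 by rewrite /= uphalf_double.
have [h1 h2 h3 h4] : [/\ (n.+4 <= n.*2.+4)%N, (n.+2 <= n.*2.+4)%N,
  (n.+1 <= n.*2.+4)%N & (n.+3 <= n.*2.+4)%N] by split; lia.
by rewrite (psi_recE h1) (psi_recE h2) (psi_recE h3) (psi_recE h4).
Qed.

Lemma psi_even_div n : (3 <= n)%N ->
  psi n.*2 = (psi n.-1 ^+ 2 * psi n * psi n.+2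
              - psi n.-2 * psi n * psi n.+1 ^+ 2) %/ psi2.
Proof.
case: n => [|[|[|n]]] // _.
rewrite {1}/psi !doubleS psi_recS; cbv zeta.
have -> : odd n.*2.+4.+2 = false by rewrite /= odd_double.
have -> : (n.*2.+4.+2)./2 = n.+3 by rewrite /= doubleK.
have [h1 h2 h3] : [/\ (n.+4.+1 <= n.*2.+4.+1)%N, (n.+4 <= n.*2.+4.+1)%N &
  (n.+3 <= n.*2.+4.+1)%N] by split; lia.
have h4 := ltnW h3; have h5 := ltnW h4.
by rewrite (psi_recE h1) (psi_recE h2) (psi_recE h3) (psi_recE h4)
  (psi_recE h5).
Qed.

Lemma lead_coef_psi2 : lead_coef psi2 = 2.
Proof.
have n2 : 2%:R%:P != 0 :> {poly F} by rewrite polyC_eq0 pnatr_eq0.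
have -> : psi2 = 2%:R%:P%:P * 'X + (a1%:P * 'X + a3%:P)%:P.
  rewrite /psi2 /bX /bC /bY [(_ * _ + _)%:P]polyCD [(_ * 'X)%:P]polyCM addrA.
  by rewrite !polyC_natr.
rewrite lead_coefDl; first by rewrite lead_coefMX lead_coefC polyC_natr.
rewrite size_mulX; last by rewrite polyC_eq0.
by rewrite ltnS (size_polyC 2%:P) n2; apply: size_polyC_leq1.
Qed.

Lemma mulpsi2K (p : {poly {poly F}}) : (p * psi2) %/ psi2 = p.
Proof.
apply: Pdiv.IdomainUnit.mulpK; rewrite lead_coef_psi2.
by rewrite -polyC_natr rmorph_unit // unitfE pnatr_eq0.
Qed.

Lemma mul2psi2K (p : {poly {poly F}}) : (p * (2 * psi2)) %/ (2 * psi2) = p.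
Proof.
apply: Pdiv.IdomainUnit.mulpK.
rewrite lead_coefM lead_coef_psi2 -[X in lead_coef X](polyC_natr _ 2).
rewrite lead_coefC -natrM -polyC_natr rmorph_unit //.
by rewrite unitfE pnatr_eq0.
Qed.

Lemma psi_even_psi2 n : exists q, psi n.*2 = q * psi2.
Proof.
elim/ltn_ind: n => n IH.
have [n3|n3] := leqP 3 n; last first.
  case: n n3 {IH} => [|[|[|]]] // _.
  - by exists 0; rewrite mul0r.
  - by exists 1; rewrite mul1r.
  - by eexists; rewrite /psi /= /psi4 mulrC.
rewrite (psi_even_div n3).
have [m En] : exists m, n = m.*2 \/ n = m.*2.+1 by exists n./2; lia.
case: En => En.
  have [q0 E0] := IH m.-1 ltac:(lia).
  have [q1 E1] := IH m ltac:(lia).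
  have [q2 E2] := IH m.+1 ltac:(lia).
  rewrite (_ : n.-2 = m.-1.*2); last lia.
  rewrite (_ : n.+2 = m.+1.*2); last lia.
  have E1' : psi n = q1 * psi2 by rewrite En.
  rewrite E0 E1' E2.
  exists (psi n.-1 ^+ 2 * q1 * q2 - q0 * q1 * psi n.+1 ^+ 2).
  by rewrite -[RHS]mulpsi2K; congr (_ %/ _); ring.
have [q1 E1] := IH m ltac:(lia).
have [q2 E2] := IH m.+1 ltac:(lia).
have F1 : n.-1 = m.*2 by lia.
have F2 : n.+1 = m.+1.*2 by lia.
rewrite -F1 in E1; rewrite -F2 in E2.
rewrite E1 E2.
exists (q1 ^+ 2 * psi n * psi n.+2 - psi n.-2 * psi n * q2 ^+ 2).
by rewrite -[RHS]mulpsi2K; congr (_ %/ _); ring.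
Qed.

Lemma omega_dvd n : (2 <= n)%N ->
  exists q, psi n.-1 ^+ 2 * psi n.+2 - psi n.-2 * psi n.+1 ^+ 2 = q * psi2.
Proof.
move=> n2.
have [m En] : exists m, n = m.*2 \/ n = m.*2.+1 by exists n./2; lia.
case: En => En.
  have [q0 E0] := psi_even_psi2 m.-1.
  have [q2 E2] := psi_even_psi2 m.+1.
  rewrite (_ : n.-2 = m.-1.*2); last lia.
  rewrite (_ : n.+2 = m.+1.*2); last lia.
  exists (psi n.-1 ^+ 2 * q2 - q0 * psi n.+1 ^+ 2).
  by rewrite E0 E2; ring.
have [q1 E1] := psi_even_psi2 m.
have [q2 E2] := psi_even_psi2 m.+1.
have F1 : n.-1 = m.*2 by lia.
have F2 : n.+1 = m.+1.*2 by lia.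
rewrite -F1 in E1; rewrite -F2 in E2.
exists (q1 ^+ 2 * psi2 * psi n.+2 - psi n.-2 * q2 ^+ 2 * psi2).
by rewrite E1 E2; ring.
Qed.

Lemma psi_even n : (3 <= n)%N ->
  psi n.*2 * psi2 = psi n.-1 ^+ 2 * psi n * psi n.+2
                    - psi n.-2 * psi n * psi n.+1 ^+ 2.
Proof.
move=> n3; rewrite (psi_even_div n3).
have [q Eq] := omega_dvd (ltnW n3).
have ER : psi n.-1 ^+ 2 * psi n * psi n.+2
          - psi n.-2 * psi n * psi n.+1 ^+ 2 = psi n * q * psi2.
  by rewrite -(mulrA (psi n)) -Eq; ring.
by rewrite ER mulpsi2K.
Qed.

Lemma omegaE n : (2 <= n)%N ->
  omega n * (2 * psi2) =
    psi n.-1 ^+ 2 * psi n.+2 - psi n.-2 * psi n.+1 ^+ 2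
    - psi2 * psi n * (bC a1 * phi n + bC a3 * psi n ^+ 2).
Proof.
move=> n2; have [q Eq] := omega_dvd n2.
have -> : omega n = (psi n.-1 ^+ 2 * psi n.+2 - psi n.-2 * psi n.+1 ^+ 2
    - psi2 * psi n * (bC a1 * phi n + bC a3 * psi n ^+ 2)) %/ (2 * psi2).
  by case: n n2 {Eq} => [|[|n]].
rewrite Eq; set u := bC a1 * phi n + bC a3 * psi n ^+ 2.
have h : bC 2^-1 * 2 = 1.
  by rewrite /bC -(polyC_natr _ 2) -(polyC_natr F 2) -!polyCM mulVf ?pnatr_eq0.
have -> : q * psi2 - psi2 * psi n * u
          = bC 2^-1 * (q - psi n * u) * (2 * psi2).
  by rewrite mulrACA h mul1r; ring.
by rewrite mul2psi2K.
Qed.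

End DivisionPolynomials.

Definition beta (alpha : int) : int := (2 * alpha - 1) * (alpha - 1).

Definition E8 (alpha : int) : weierstrass rat :=
  {| wa1 := (alpha - beta alpha)%:~R;
     wa2 := (- (alpha ^+ 2 * beta alpha))%:~R;
     wa3 := (- (alpha ^+ 3 * beta alpha))%:~R;
     wa4 := 0;
     wa6 := 0 |}.

Lemma E8_disc_neq0 (alpha : int) :
  alpha != 0 -> alpha != 1 -> wdisc (E8 alpha) != 0.
Proof.
move=> h0 h1.
have -> : wdisc (E8 alpha) =
  (alpha ^+ 8 * (alpha - 1) ^+ 8 * (2 * alpha - 1) ^+ 4
   * (8 * alpha ^+ 2 - 8 * alpha + 1))%:~R.
  rewrite /wdisc /wb2 /wb4 /wb6 /wb8 /E8 /beta /=; ring.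
rewrite intr_eq0 !mulf_neq0 ?expf_neq0 //; lia.
Qed.

(* Values of phi_n and omega_n at P = (0, 0). *)
Definition G (alpha : int) (n : nat) : rat := beval (phi (E8 alpha) n) 0 0.
Definition H (alpha : int) (n : nat) : rat := beval (omega (E8 alpha) n) 0 0.

(* In each function below the default branch also covers the residues left
   unspecified, at which the corresponding G_n or H_n vanishes. *)
Definition exp_a1 (n : nat) : int :=
  match (n %% 8)%N with 2 | 6 => 4 | 3 | 5 => 1 | 4 => 8 | _ => 0 end.

Definition exp_b1 (n : nat) : int :=
  match (n %% 8)%N with 2 | 6 => 4 | 3 | 5 => 7 | 4 => 8 | _ => 0 end.

Definition exp_c1 (n : nat) : int :=
  match (n %% 8)%N with 3 | 5 => 1 | _ => 0 end.

Definition exp_a2 (n : nat) : int :=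
  match (n %% 8)%N with
  | 2 => -4 | 3 => 11 | 4 => 16 | 5 => -5 | 7 => 3 | _ => 0
  end.

Definition exp_b2 (n : nat) : int :=
  match (n %% 8)%N with
  | 2 => 4 | 3 | 5 => 13 | 4 => 16 | 7 => 5 | _ => 0
  end.

Definition exp_c2 (n : nat) : int :=
  match (n %% 8)%N with 2 => -4 | 3 | 7 => 1 | 5 => -7 | _ => 0 end.

Definition eps (n : nat) : rat :=
  if (n %% 16)%N \in [:: 0; 4; 5; 10; 13]%N then 1 else -1.

Lemma sqr_div8 (n : nat) : exists q s : nat,
  n%:Z ^+ 2 = 64 * s%:Z + 16 * q%:Z * (n %% 8)%N%:Z + (n %% 8)%N%:Z ^+ 2.
Proof.
exists (n %/ 8)%N, (n %/ 8 * (n %/ 8))%N.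
by rewrite {1}(divn_eq n 8) PoszD !PoszM; ring.
Qed.

(* The divisions appearing in the exponents of G_n and H_n are exact, with
   nonnegative quotients. *)
Lemma exponents_G (n : nat) : (n %% 8)%N \notin [:: 1; 7]%N ->
  [/\ (8 %| 15 * n%:Z ^+ 2 + exp_a1 n)%Z && (0 <= 15 * n%:Z ^+ 2 + exp_a1 n),
      (8 %| 7 * n%:Z ^+ 2 - exp_b1 n)%Z && (0 <= 7 * n%:Z ^+ 2 - exp_b1 n) &
      (4 %| 3 * n%:Z ^+ 2 + exp_c1 n)%Z && (0 <= 3 * n%:Z ^+ 2 + exp_c1 n)].
Proof.
have [q [s ->]] := sqr_div8 n; rewrite /exp_a1 /exp_b1 /exp_c1.
case: (n %% 8)%N (ltn_pmod n (isT : 0 < 8)%N) => [|[|[|[|[|[|[|[|r]]]]]]]] r8;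
  rewrite // => _; split; apply/andP; split; lia.
Qed.

Lemma exponents_H (n : nat) : (n %% 8)%N \notin [:: 1; 6]%N ->
  [/\ (16 %| 45 * n%:Z ^+ 2 + exp_a2 n)%Z && (0 <= 45 * n%:Z ^+ 2 + exp_a2 n),
      (16 %| 21 * n%:Z ^+ 2 - exp_b2 n)%Z && (0 <= 21 * n%:Z ^+ 2 - exp_b2 n) &
      (8 %| 9 * n%:Z ^+ 2 - exp_c2 n)%Z && (0 <= 9 * n%:Z ^+ 2 - exp_c2 n)].
Proof.
have [q [s ->]] := sqr_div8 n; rewrite /exp_a2 /exp_b2 /exp_c2.
case: (n %% 8)%N (ltn_pmod n (isT : 0 < 8)%N) => [|[|[|[|[|[|[|[|r]]]]]]]] r8;
  rewrite // => _; split; apply/andP; split; lia.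
Qed.

(* Main.v *)
Require Import Defs.
From mathcomp Require Import all_boot all_order all_algebra.
From mathcomp Require Import zify ring.
Import Order.TTheory GRing.Theory Num.Theory.
Local Open Scope ring_scope.

(** Write p = alpha, q = alpha - 1, r = 2 alpha - 1, and h_n for the value of
    psi_n at P = (0, 0). Since P has order 8, the elliptic divisibility
    sequence h vanishes at the multiples of 8 and, by a phenomenon that goes
    back to Ward, it is quasi-periodic:

      h_(n+8) = A^n B h_n,  where A = - p^15 q^7 r^6 and B = - A^4.

    Quasi-periodicity is not deduced here from the group law. The duplication
    recurrences that define the division polynomials are homogeneous in a
    sense that makes them compatible with h_(Nj+t) = A^(jt) B^(j^2) h_t as soon
    as B^2 = A^N, so the relation for small n propagates to all n
    ([elliptic_shift]). The small values h_0, ..., h_19 are monomials in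
    p, q, r up to sign, or zero; they are determined by h_0, ..., h_4 and
    satisfy the relation ([elliptic_table], [table_shift]).

    The formulas for phi_n and omega_n in terms of psi are homogeneous of
    weights 2 and 3, so G_(n+8) = A^(2n) B^2 G_n = A^(2n+8) G_n and
    H_(n+8) = A^(3n) B^3 H_n = - A^(3n+12) H_n. The closed forms obey the same
    two relations: (n+8)^2 - n^2 = 16n + 64 shifts the exponents of p, q, r by
    15, 7, 6 times 2n + 8 in G and 3n + 12 in H, and the sign
    - (-1)^(3n+12) = (-1)^(n+1) is exactly how epsilon changes. It remains to
    compare the values for n < 10. *)

(** * Quasi-periodicity of elliptic sequences *)

(** The even relation is also imposed for m = 2, where it holds for any h with
    h 0 = 0 and h 1 = 1; this spares a case distinction below. *)
Definition elliptic {R : nzRingType} (h : nat -> R) : Prop :=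
  (forall m, (2 <= m)%N ->
     h m.*2.+1 = h m.+2 * h m ^+ 3 - h m.-1 * h m.+1 ^+ 3) /\
  (forall m, (2 <= m)%N ->
     h m.*2 * h 2%N =
       h m.-1 ^+ 2 * h m * h m.+2 - h m.-2 * h m * h m.+1 ^+ 2).

Lemma elliptic_rmorph (R S : nzRingType) (f : {rmorphism R -> S})
    (h : nat -> R) : elliptic h -> elliptic (f \o h).
Proof.
case=> hodd heven; split=> m m2 /=.
  by rewrite hodd // rmorphB !(rmorphXn, rmorphM).
by rewrite -rmorphM heven // rmorphB !(rmorphXn, rmorphM).
Qed.

(** Iterating the shift by N produces the factor A^(N(0 + ... + (j-1))), which
    is a power of B because B^2 = A^N; hence the exponent j^2. *)
Lemma shift_iter (R : idomainType) (h : nat -> R) (A B : R) (N M : nat) :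
  B ^+ 2 = A ^+ N ->
  (forall t, (t < M)%N -> h (N + t)%N = A ^+ t * B * h t) ->
  forall j t, (N * j + t < N + M)%N ->
    h (N * j + t)%N = A ^+ (j * t) * B ^+ (j ^ 2) * h t.
Proof.
move=> BA hM; elim=> [|j IH] t lt; first by rewrite muln0 mul0n !expr0 !mul1r.
rewrite mulnS -addnA hM; last by rewrite mulnS in lt; lia.
rewrite IH; last by rewrite mulnS in lt; lia.
have -> : (j.+1 * t = j * t + t)%N by lia.
have -> : (j.+1 ^ 2 = 2 * j + (j ^ 2 + 1))%N by lia.
have E : B ^+ (2 * j) = A ^+ (N * j) by rewrite !exprM BA.
by rewrite (exprD B) E !exprD; ring.
Qed.

(** For the inductive step write N + n = 2 (N j + s) + e with s at most N + 1
    and e at most 1. The recurrence for h (N + n) involves only the indices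
    N j + (s + i), |i| <= 2. Both of its terms have four factors and index
    total 4 s + 2 e; so the factors A^(j (s+i)) B^(j^2) multiply to
    A^(2j(2s+e)) B^(4j^2), and what remains is the same recurrence for
    h (2 s + e). *)
Lemma elliptic_shift (R : idomainType) (h : nat -> R) (A B : R) (N : nat) :
  elliptic h -> h 2%N != 0 -> (0 < N)%N -> B ^+ 2 = A ^+ N ->
  (forall t, (t < N + 4)%N -> h (N + t)%N = A ^+ t * B * h t) ->
  forall n, h (N + n)%N = A ^+ n * B * h n.
Proof.
move=> [hodd heven] h2 N0 BA base; elim/ltn_ind=> n IH.
have [/base //|nN] := ltnP n (N + 4)%N.
have step := shift_iter R h A B N n BA IH.
have [j [s [e [j0 s2 sN e1 En]]]] : exists j s e : nat,
  [/\ (0 < j)%N, (2 <= s)%N, (s <= N.+1)%N, (e <= 1)%N &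
      (N + n = 2 * (N * j + s) + e)%N].
  set m := ((N + n) %/ 2)%N.
  exists ((m - 2) %/ N)%N, ((m - 2) %% N + 2)%N, ((N + n) %% 2)%N.
  have := divn_eq (m - 2) N; have := ltn_pmod (m - 2) N0.
  have : (N <= m - 2)%N by lia.
  move=> Nm lt E; have := @leq_div2r N _ _ Nm; rewrite divnn N0 => d1.
  by split; lia.
have small i : (i <= s + 2)%N ->
    h (N * j + i)%N = A ^+ (j * i) * B ^+ (j ^ 2) * h i.
  by move=> lei; apply: step; lia.
have EN : (n = N * (2 * j - 1) + (2 * s + e))%N.
  have NNj : (N <= N * j)%N by rewrite leq_pmulr.
  have -> : (N * (2 * j - 1) = 2 * (N * j) - N)%N.
    by rewrite mulnBr muln1 mulnCA.
  by lia.
have hn : h n = A ^+ ((2 * j - 1) * (2 * s + e)) * B ^+ ((2 * j - 1) ^ 2)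
                * h (2 * s + e)%N.
  by rewrite -step -?EN //; lia.
have j2 : (2 * j = (2 * j - 1) + 1)%N by lia.
have EA : (2 * j * (2 * s + e) = (2 * j - 1) * (2 * s + e) + (2 * s + e))%N.
  by rewrite {1}j2 mulnDl mul1n.
have EB : ((2 * j) ^ 2 = (2 * j - 1) ^ 2 + (2 * (2 * j - 1) + 1))%N.
  by rewrite {1}j2 sqrnD muln1 exp1n; lia.
(* Once h (N + n) and h n are both expressed through h (2 s + e), their ratio
   is A^n B by another use of B^2 = A^N. *)
suff -> : h (N + n)%N = A ^+ (2 * j * (2 * s + e)) * B ^+ ((2 * j) ^ 2)
                        * h (2 * s + e)%N.
  have E : B ^+ (2 * (2 * j - 1)) = A ^+ (N * (2 * j - 1)) by rewrite !exprM BA.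
  rewrite hn EA EB {1}EN (exprD B (_ ^ 2)) (exprD B (2 * _)) E !(exprD A).
  by ring.
have hsub1 : h (N * j + s).-1 = A ^+ (j * s.-1) * B ^+ (j ^ 2) * h s.-1.
  by rewrite -small; [congr h | ]; lia.
have hsub2 : h (N * j + s).-2 = A ^+ (j * s.-2) * B ^+ (j ^ 2) * h s.-2.
  by rewrite -small; [congr h | ]; lia.
have hs := small s ltac:(lia).
have hadd1 : h (N * j + s).+1 = A ^+ (j * s.+1) * B ^+ (j ^ 2) * h s.+1.
  by rewrite -small; [congr h | ]; lia.
have hadd2 : h (N * j + s).+2 = A ^+ (j * s.+2) * B ^+ (j ^ 2) * h s.+2.
  by rewrite -small; [congr h | ]; lia.
have Ab : B ^+ ((2 * j) ^ 2) = (B ^+ (j ^ 2)) ^+ 4.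
  by rewrite -exprM; congr (_ ^+ _); lia.
have Aa x : A ^+ (2 * j * x) = (A ^+ j) ^+ (2 * x).
  by rewrite -exprM; congr (_ ^+ _); lia.
have [e0|{}e1] : (e = 0 \/ e = 1)%N by lia.
- apply: (mulIf h2); rewrite En e0 !addn0 !mul2n heven; last by lia.
  rewrite hsub1 hsub2 hs hadd1 hadd2 -(mulrA _ (h s.*2)) heven //.
  case: s s2 {hsub1 hsub2 hs hadd1 hadd2 sN En small hn EA EN}
    => [|[|s]] // _.
  rewrite -[j.*2]mul2n -[s.+2.*2]mul2n /= Ab [A ^+ (2 * _ * _)]Aa !(exprM A j).
  have -> : A ^+ j ^+ (2 * (2 * s.+2)) = (A ^+ j ^+ s) ^+ 4 * (A ^+ j) ^+ 8.
    by rewrite -[_ ^+ 4]exprM -exprD; congr (_ ^+ _); lia.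
  by rewrite !exprS; ring.
rewrite En e1 !mul2n !addn1 hodd; last by lia.
rewrite hsub1 hs hadd1 hadd2 hodd //.
case: s s2 {hsub1 hsub2 hs hadd1 hadd2 sN En small hn EA EN} => [|[|s]] // _.
rewrite -[j.*2]mul2n /= Ab [A ^+ (2 * _ * _)]Aa !(exprM A j).
have -> : A ^+ j ^+ (2 * s.+2.*2.+1) = (A ^+ j ^+ s) ^+ 4 * (A ^+ j) ^+ 10.
  by rewrite -[_ ^+ 4]exprM -exprD; congr (_ ^+ _); lia.
by rewrite !exprS; ring.
Qed.

(** * The first twenty values *)

Definition mon {F : fieldType} (p : F) (i j k : nat) : F :=
  p ^+ i * (p - 1) ^+ j * (2 * p - 1) ^+ k.

Lemma mon_neq0 (F : fieldType) (p : F) i j k :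
  p * (p - 1) * (2 * p - 1) != 0 -> mon p i j k != 0.
Proof.
rewrite !mulf_eq0 !negb_or -andbA => /and3P[p0 q0 r0].
by rewrite /mon !(mulf_eq0, expf_eq0, negb_or, negb_and) p0 q0 r0 !orbT.
Qed.

(** The multipliers A and B of the quasi-period 8. They are read off from
    h_9 = A B and h_10 = A^2 B h_2. *)
Definition stepA {F : fieldType} (p : F) : F := - mon p 15 7 6.
Definition stepB {F : fieldType} (p : F) : F := - stepA p ^+ 4.

Definition table {F : fieldType} (p : F) : seq F :=
  [:: 0; 1; - mon p 3 1 1; - mon p 8 3 3; mon p 14 6 6; mon p 23 10 9;
      - mon p 33 15 13; - mon p 45 21 18; 0; mon p 75 35 30; mon p 93 43 37;
      - mon p 113 52 45; - mon p 134 62 54; mon p 158 73 63;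
      mon p 183 85 73; - mon p 210 98 84; 0; mon p 270 126 108;
      - mon p 303 141 121; - mon p 338 157 135].

Lemma table_odd (F : fieldType) (p : F) m : (2 <= m < 10)%N ->
  let t := nth 0 (table p) in
  t m.*2.+1 = t m.+2 * t m ^+ 3 - t m.-1 * t m.+1 ^+ 3.
Proof.
do 10?[case: m => [|m] //]; move=> _; rewrite /= /mon.
(* For m >= 6 a term vanishes and the identity already holds between
   monomials in independent p, q, r; only the smaller m use the relations
   q = p - 1 and r = 2 p - 1, and there expansion in p is cheap. *)
all: first [by move: (p - 1) (2 * p - 1) => q r; ring | by ring].
Qed.

Lemma table_even (F : fieldType) (p : F) m : (2 <= m < 10)%N ->
  let t := nth 0 (table p) in
  t m.*2 * t 2%N = t m.-1 ^+ 2 * t m * t m.+2 - t m.-2 * t m * t m.+1 ^+ 2.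
Proof.
do 10?[case: m => [|m] //]; move=> _; rewrite /= /mon.
all: first [by move: (p - 1) (2 * p - 1) => q r; ring | by ring].
Qed.

(** The recurrences determine an elliptic sequence with h 2 != 0 from its
    first five values, and the table satisfies them. *)
Lemma elliptic_table (F : fieldType) (p : F) (h : nat -> F) :
  p * (p - 1) * (2 * p - 1) != 0 -> elliptic h ->
  (forall n, (n < 5)%N -> h n = (table p)`_n) ->
  forall n, (n < 20)%N -> h n = (table p)`_n.
Proof.
move=> pqr [hodd heven] h5; elim/ltn_ind=> n IH n20.
have [/h5 //|n5] := ltnP n 5.
have [m [En m2 m10]] : exists m, [/\ n = m.*2 \/ n = m.*2.+1, (2 <= m)%N &
  (m < 10)%N] by exists n./2; split; lia.
have hm i : (i <= m.+2)%N -> (i < n)%N -> h i = (table p)`_i.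
  by move=> ??; apply: IH; lia.
case: En => En; rewrite En; last first.
  by rewrite table_odd ?m2 // hodd // !hm //; lia.
have t2 : (table p)`_2 != 0 by rewrite oppr_eq0 mon_neq0.
apply: (mulIf t2); rewrite table_even ?m2 // -!hm ?heven //; lia.
Qed.

Lemma table_shift (F : fieldType) (p : F) t : (t < 12)%N ->
  (table p)`_(8 + t) = stepA p ^+ t * stepB p * (table p)`_t.
Proof.
by do 12?[case: t => [|t] //]; move=> _; rewrite /stepB /stepA /= /mon;
  move: (p - 1) (2 * p - 1) => q r; ring.
Qed.

(** * Division polynomials at the origin *)

Lemma elliptic_psi (F : numFieldType) (E : weierstrass F) : elliptic (psi E).
Proof.
split=> m m2; first exact: psi_odd.
have [m3|m3] := leqP 3 m; first exact: psi_even.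
have -> : m = 2%N by lia.
by rewrite /psi /=; ring.
Qed.

(** Evaluation at P in the form of a ring morphism, so that it commutes with
    the recurrences. *)
Definition eval_origin (F : numFieldType) :
  {rmorphism {poly {poly F}} -> F} := horner_eval 0 \o horner_eval 0%:P.

Lemma eval_originC (F : numFieldType) (c : F) : eval_origin F (bC c) = c.
Proof. by rewrite /eval_origin /= /horner_eval /bC !hornerC. Qed.

Lemma eval_originX (F : numFieldType) : eval_origin F (bX F) = 0.
Proof. by rewrite /eval_origin /= /horner_eval /bX !hornerE. Qed.

Lemma eval_originY (F : numFieldType) : eval_origin F (bY F) = 0.
Proof. by rewrite /eval_origin /= /horner_eval /bY !hornerE. Qed.

Lemma eval_origin_psi (F : numFieldType) (E : weierstrass F) :
  [/\ eval_origin F (psi E 2) = wa3 E, eval_origin F (psi E 3) = wb8 E &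
      eval_origin F (psi E 4) = wa3 E * (wb4 E * wb8 E - wb6 E ^+ 2)].
Proof.
move: (eval_origin F) (@eval_originC F) (eval_originX F) (eval_originY F).
move=> f fC fX fY; rewrite /psi /= /psi4 /psi3 /psi2.
by split; rewrite !(rmorph_nat, rmorphXn, rmorphD, rmorphM, fC, fX, fY); ring.
Qed.

Definition psiP (alpha : int) (n : nat) : rat :=
  eval_origin rat (psi (E8 alpha) n).

Lemma elliptic_psiP alpha : elliptic (psiP alpha).
Proof. by apply: elliptic_rmorph; apply: elliptic_psi. Qed.

Lemma psiP_init (alpha : int) n :
  (n < 5)%N -> psiP alpha n = (table (alpha%:~R : rat))`_n.
Proof.
have [e2 e3 e4] := eval_origin_psi rat (E8 alpha); rewrite /psiP.
case: n => [|[|[|[|[|n]]]]] // _; rewrite ?rmorph0 ?rmorph1 // ?(e2, e3, e4).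
all: rewrite /wb2 /wb4 /wb6 /wb8 /mon /= /mon /beta; ring.
Qed.

Lemma pqr_neq0 (alpha : int) : alpha != 0 -> alpha != 1 ->
  alpha%:~R * (alpha%:~R - 1) * (2 * alpha%:~R - 1) != 0 :> rat.
Proof.
move=> a0 a1.
have -> : alpha%:~R * (alpha%:~R - 1) * (2 * alpha%:~R - 1)
    = (alpha * (alpha - 1) * (2 * alpha - 1))%:~R :> rat by ring.
by rewrite intr_eq0 !mulf_neq0 //; lia.
Qed.

Lemma psiP_table (alpha : int) n : alpha != 0 -> alpha != 1 ->
  (n < 20)%N -> psiP alpha n = (table (alpha%:~R : rat))`_n.
Proof.
move=> a0 a1; move: n.
exact: elliptic_table (pqr_neq0 _ a0 a1) (elliptic_psiP _) (psiP_init _).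
Qed.

Lemma psiP2_neq0 alpha : alpha != 0 -> alpha != 1 -> psiP alpha 2 != 0.
Proof. by move=> *; rewrite psiP_init //= oppr_eq0 mon_neq0 // pqr_neq0. Qed.

Lemma psiP_shift (alpha : int) (n : nat) : alpha != 0 -> alpha != 1 ->
  let p : rat := alpha%:~R in
  psiP alpha (8 + n) = stepA p ^+ n * stepB p * psiP alpha n.
Proof.
move=> a0 a1 p; apply: elliptic_shift => //.
- exact: elliptic_psiP.
- exact: psiP2_neq0.
- by rewrite /stepB; ring.
- by move=> t t12; rewrite !psiP_table ?table_shift //; lia.
Qed.

(** * Shifting numerators by the order of the point *)

Lemma G_psi (alpha : int) n : (2 <= n)%N ->
  G alpha n = - (psiP alpha n.+1 * psiP alpha n.-1).
Proof.
case: n => [|[|n]] // _.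
rewrite /G -[beval _ 0 0]/(eval_origin rat _) /phi /psiP.
by rewrite rmorphB !rmorphM eval_originX mul0r sub0r.
Qed.

Lemma H_psi (alpha : int) n : (2 <= n)%N ->
  let E := E8 alpha in
  H alpha n * (2 * psiP alpha 2) =
    psiP alpha n.-1 ^+ 2 * psiP alpha n.+2
    - psiP alpha n.-2 * psiP alpha n.+1 ^+ 2
    - psiP alpha 2 * psiP alpha n
      * (wa1 E * G alpha n + wa3 E * psiP alpha n ^+ 2).
Proof.
move=> n2; rewrite /H /G -[beval _ 0 0]/(eval_origin rat _).
rewrite -[beval (phi _ _) 0 0]/(eval_origin rat _).
have := congr1 (eval_origin rat) (omegaE (E8 alpha) n2).
rewrite /psiP -[psi2 _]/(psi _ 2).
(* Abstracting the morphism and the polynomials keeps the rewriting below from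
   unfolding them during unification. *)
move: (eval_origin rat) (@eval_originC rat) (psi _) (phi _ n) (omega _ n).
move=> f fC u v w.
by rewrite !(rmorph_nat, rmorphXn, rmorphM, rmorphB, rmorphD, fC).
Qed.

Lemma G_shift (alpha : int) n : alpha != 0 -> alpha != 1 -> (2 <= n)%N ->
  G alpha (8 + n) = stepA (alpha%:~R : rat) ^+ (2 * n + 8) * G alpha n.
Proof.
move=> a0 a1 n2; have sh k := psiP_shift alpha k a0 a1; simpl in sh.
rewrite !G_psi //.
case: n n2 => [|n] // _; rewrite -[(8 + n.+1).+1]/(8 + n.+2)%N.
rewrite -[(8 + n.+1).-1]/(8 + n)%N !sh /stepB /=.
move: (stepA _) => A.
have -> : A ^+ (2 * n.+1 + 8) = A ^+ n ^+ 2 * A ^+ 10.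
  by rewrite -exprM -exprD; congr (_ ^+ _); lia.
by rewrite !exprS; ring.
Qed.

Lemma H_shift (alpha : int) n : alpha != 0 -> alpha != 1 -> (2 <= n)%N ->
  let p : rat := alpha%:~R in
  H alpha (8 + n) = stepA p ^+ (3 * n) * stepB p ^+ 3 * H alpha n.
Proof.
move=> a0 a1 n2; have sh k := psiP_shift alpha k a0 a1; simpl in sh.
have h2 : 2 * psiP alpha 2 != 0 by rewrite mulf_neq0 // psiP2_neq0.
apply: (mulIf h2); rewrite -[RHS]mulrA !H_psi // G_shift //.
case: n n2 => [|[|n]] // _.
rewrite -[(8 + n.+2).+1]/(8 + n.+3)%N -[(8 + n.+2).+2]/(8 + n.+4)%N.
rewrite -[(8 + n.+2).-1]/(8 + n.+1)%N -[(8 + n.+2).-2]/(8 + n)%N !sh.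
rewrite /stepB; move: (stepA _) (wa1 _) (wa3 _) => A w1 w3 /=.
have -> : A ^+ (2 * n.+2 + 8) = A ^+ n ^+ 2 * A ^+ 12.
  by rewrite -exprM -exprD; congr (_ ^+ _); lia.
have -> : A ^+ (3 * n.+2) = A ^+ n ^+ 3 * A ^+ 6.
  by rewrite -exprM -exprD; congr (_ ^+ _); lia.
by rewrite !exprS; ring.
Qed.

(** * Shifting the closed forms by eight *)

Definition Gclosed (alpha : int) (n : nat) : rat :=
  if (n %% 8)%N \in [:: 1; 7]%N then 0
  else alpha%:~R ^ ((15 * n%:Z ^+ 2 + exp_a1 n) %/ 8)%Z
       * (alpha - 1)%:~R ^ ((7 * n%:Z ^+ 2 - exp_b1 n) %/ 8)%Z
       * (2 * alpha - 1)%:~R ^ ((3 * n%:Z ^+ 2 + exp_c1 n) %/ 4)%Z.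

Definition Hclosed (alpha : int) (n : nat) : rat :=
  if (n %% 8)%N \in [:: 1; 6]%N then 0
  else eps n
       * alpha%:~R ^ ((45 * n%:Z ^+ 2 + exp_a2 n) %/ 16)%Z
       * (alpha - 1)%:~R ^ ((21 * n%:Z ^+ 2 - exp_b2 n) %/ 16)%Z
       * (2 * alpha - 1)%:~R ^ ((9 * n%:Z ^+ 2 - exp_c2 n) %/ 8)%Z.

Lemma stepAX (alpha : int) m : stepA (alpha%:~R : rat) ^+ m =
  (-1) ^+ m * alpha%:~R ^+ (15 * m) * (alpha - 1)%:~R ^+ (7 * m)
  * (2 * alpha - 1)%:~R ^+ (6 * m).
Proof.
by rewrite !exprM -!exprMn; congr (_ ^+ _); rewrite /stepA /mon; ring.
Qed.

Lemma divz_add (d a b q : int) :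
  d != 0 -> b = q * d + a -> (b %/ d)%Z = (a %/ d)%Z + q.
Proof. by move=> d0 ->; rewrite divzMDl // addrC. Qed.

Lemma Gclosed_shift (alpha : int) n : alpha != 0 -> alpha != 1 ->
  Gclosed alpha (8 + n)
    = stepA (alpha%:~R : rat) ^+ (2 * n + 8) * Gclosed alpha n.
Proof.
move=> a0 a1; rewrite /Gclosed modnDl; case: ifP => _; first by rewrite mulr0.
have p0 : alpha%:~R != 0 :> rat by rewrite intr_eq0.
have q0 : (alpha - 1)%:~R != 0 :> rat by rewrite intr_eq0; lia.
have r0 : (2 * alpha - 1)%:~R != 0 :> rat by rewrite intr_eq0; lia.
rewrite {1}/exp_a1 {1}/exp_b1 {1}/exp_c1 modnDl.
rewrite -/(exp_a1 n) -/(exp_b1 n) -/(exp_c1 n).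
have -> : ((15 * (8 + n)%N%:Z ^+ 2 + exp_a1 n) %/ 8)%Z
    = ((15 * n%:Z ^+ 2 + exp_a1 n) %/ 8)%Z + (15 * (2 * n + 8))%N.
  by apply: divz_add => //; rewrite !(PoszD, PoszM); ring.
have -> : ((7 * (8 + n)%N%:Z ^+ 2 - exp_b1 n) %/ 8)%Z
    = ((7 * n%:Z ^+ 2 - exp_b1 n) %/ 8)%Z + (7 * (2 * n + 8))%N.
  by apply: divz_add => //; rewrite !(PoszD, PoszM); ring.
have -> : ((3 * (8 + n)%N%:Z ^+ 2 + exp_c1 n) %/ 4)%Z
    = ((3 * n%:Z ^+ 2 + exp_c1 n) %/ 4)%Z + (6 * (2 * n + 8))%N.
  by apply: divz_add => //; rewrite !(PoszD, PoszM); ring.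
have sgn : (-1) ^+ (2 * n + 8) = 1 :> rat by rewrite -signr_odd oddD oddM.
by rewrite !expfzDr // -!exprnP stepAX sgn mul1r; ring.
Qed.

Lemma eps_shift n : (n %% 8)%N \notin [:: 1; 6]%N ->
  eps (8 + n) = - (-1) ^+ n * eps n.
Proof.
have n8 : (n %% 8 = n %% 16 %% 8)%N by rewrite modn_dvdm.
have n2 : odd n = odd (n %% 16).
  by rewrite [in LHS](divn_eq n 16) oddD oddM andbF.
have n16 : ((8 + n) %% 16 = (8 + n %% 16) %% 16)%N by rewrite modnDmr.
rewrite /eps n16 n8 -(signr_odd _ n) n2.
move: (n %% 16)%N (ltn_pmod n (isT : 0 < 16)%N) => r; clear.
by do 16?[case: r => [|r] //].
Qed.

Lemma Hclosed_shift (alpha : int) n : alpha != 0 -> alpha != 1 ->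
  let A := stepA (alpha%:~R : rat) in let B := stepB (alpha%:~R : rat) in
  Hclosed alpha (8 + n) = A ^+ (3 * n) * B ^+ 3 * Hclosed alpha n.
Proof.
move=> a0 a1 A B; rewrite /Hclosed modnDl.
case: ifP => [_|/negbT n16]; first by rewrite mulr0.
have p0 : alpha%:~R != 0 :> rat by rewrite intr_eq0.
have q0 : (alpha - 1)%:~R != 0 :> rat by rewrite intr_eq0; lia.
have r0 : (2 * alpha - 1)%:~R != 0 :> rat by rewrite intr_eq0; lia.
rewrite {1}/exp_a2 {1}/exp_b2 {1}/exp_c2 modnDl.
rewrite -/(exp_a2 n) -/(exp_b2 n) -/(exp_c2 n).
have -> : ((45 * (8 + n)%N%:Z ^+ 2 + exp_a2 n) %/ 16)%Z
    = ((45 * n%:Z ^+ 2 + exp_a2 n) %/ 16)%Z + (15 * (3 * n + 12))%N.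
  by apply: divz_add => //; rewrite !(PoszD, PoszM); ring.
have -> : ((21 * (8 + n)%N%:Z ^+ 2 - exp_b2 n) %/ 16)%Z
    = ((21 * n%:Z ^+ 2 - exp_b2 n) %/ 16)%Z + (7 * (3 * n + 12))%N.
  by apply: divz_add => //; rewrite !(PoszD, PoszM); ring.
have -> : ((9 * (8 + n)%N%:Z ^+ 2 - exp_c2 n) %/ 8)%Z
    = ((9 * n%:Z ^+ 2 - exp_c2 n) %/ 8)%Z + (6 * (3 * n + 12))%N.
  by apply: divz_add => //; rewrite !(PoszD, PoszM); ring.
have -> : A ^+ (3 * n) * B ^+ 3 = - A ^+ (3 * n + 12).
  by rewrite /B /stepB exprD; ring.
have sgn : (-1) ^+ (3 * n + 12) = (-1) ^+ n :> rat.
  by rewrite -signr_odd oddD oddM /= addbF signr_odd.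
by rewrite !expfzDr // -!exprnP eps_shift // stepAX sgn; ring.
Qed.

(** * The small cases and the conclusion *)

(** Quotients of closed integers are computed first because simplification
    would leave them as unreadable fixpoints inside the exponents. *)
Ltac eval_divz :=
  repeat match goal with |- context [(?a %/ ?b)%Z] =>
    let v := eval vm_compute in (a %/ b)%Z in change (a %/ b)%Z with v end.

Lemma G_small (alpha : int) n : alpha != 0 -> alpha != 1 -> (n < 10)%N ->
  G alpha n = Gclosed alpha n.
Proof.
move=> a0 a1; case: n => [|[|n]].
- by rewrite /G /beval /= !hornerC.
- by rewrite /G /beval /= /bX !hornerE.
move=> n10; rewrite G_psi // !psiP_table //; [|lia|lia].
rewrite /Gclosed rmorphB rmorphB rmorphM.
do 8?[case: n n10 => [|n] n10 //]; eval_divz.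
all: rewrite -?exprnP /= /mon.
all: by move: (_%:~R) (_ - 1) (2 * _ - 1) => p q r; ring.
Qed.

Lemma H_small (alpha : int) n : alpha != 0 -> alpha != 1 -> (n < 10)%N ->
  H alpha n = Hclosed alpha n.
Proof.
move=> a0 a1; case: n => [|[|n]].
- by rewrite /H /beval /= !hornerC.
- by rewrite /H /beval /= /bY !hornerE.
move=> n10; have h2 : 2 * psiP alpha 2 != 0.
  by rewrite mulf_neq0 // psiP2_neq0.
have w1 : wa1 (E8 alpha) =
    alpha%:~R - (2 * alpha%:~R - 1) * (alpha%:~R - 1) by rewrite /= /beta; ring.
have w3 : wa3 (E8 alpha) =
    - (alpha%:~R ^+ 3 * ((2 * alpha%:~R - 1) * (alpha%:~R - 1))).
  by rewrite /= /beta; ring.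
apply: (mulIf h2); rewrite H_psi // G_psi // w1 w3 !psiP_table //; try lia.
rewrite /Hclosed rmorphB rmorphB rmorphM.
do 8?[case: n n10 => [|n] n10 //]; eval_divz.
all: rewrite -?exprnP /eps /= /mon; move: (_%:~R) => p.
(* As in the table, for n >= 6 the identity holds for independent p, q, r, and
   only the smaller n call for an expansion in p. *)
all: first [by move: (p - 1) (2 * p - 1) => q r; ring | by ring].
Qed.

Theorem theorem4p3 (alpha : int) (alpha_neq0 : alpha != 0)
    (alpha_neq1 : alpha != 1) (n : nat) :
  G alpha n =
    (if (n %% 8)%N \in [:: 1; 7]%N then 0
     else alpha%:~R ^ ((15 * n%:Z ^+ 2 + exp_a1 n) %/ 8)%Z
          * (alpha - 1)%:~R ^ ((7 * n%:Z ^+ 2 - exp_b1 n) %/ 8)%Z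
          * (2 * alpha - 1)%:~R ^ ((3 * n%:Z ^+ 2 + exp_c1 n) %/ 4)%Z)
  /\
  H alpha n =
    (if (n %% 8)%N \in [:: 1; 6]%N then 0
     else eps n
          * alpha%:~R ^ ((45 * n%:Z ^+ 2 + exp_a2 n) %/ 16)%Z
          * (alpha - 1)%:~R ^ ((21 * n%:Z ^+ 2 - exp_b2 n) %/ 16)%Z
          * (2 * alpha - 1)%:~R ^ ((9 * n%:Z ^+ 2 - exp_c2 n) %/ 8)%Z).
Proof.
rewrite -/(Gclosed alpha n) -/(Hclosed alpha n).
elim/ltn_ind: n => n IH.
have [n10|n10] := ltnP n 10; first by split; [exact: G_small|exact: H_small].
(* The step needs n - 8 >= 2, as the formulas for phi and omega start at 2. *)
have [k En k2] : exists2 k, n = (8 + k)%N & (2 <= k)%N.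
  by exists (n - 8)%N; lia.
have [Gk Hk] := IH k ltac:(lia).
by rewrite En G_shift // H_shift // Gclosed_shift // Hclosed_shift // Gk Hk.
Qed.
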